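(* Let $B$ be a Banach SSD space (Simons space) and $A\subseteq B$ a maximally $q$-positive set. (i) The functions $\Lambda_{E^A}$ and $\Lambda_{\overline{E_A}}$ belong to $\mathcal{H}(A)$ and are, respectively, the minimum and the maximum of this family, that is, $\Lambda_{E^A}\leq h\leq\Lambda_{\overline{E_A}}$ for all $h\in\mathcal{H}(A)$. (ii) Conversely, if $h:B\to\overline{\mathbb{R}}$ is a convex lower semicontinuous function such that $\Lambda_{E^A}\leq h\leq\Lambda_{\overline{E_A}}$, then $h\in\mathcal{H}(A)$. (iii) It holds $\mathcal{H}(A)=\{h:B\to\overline{\mathbb{R}}: h\text{ convex, lower semicontinuous and }\Lambda_{E^A}\leq h\leq\Lambda_{\overline{E_A}}\}$.
   Context: A symmetrically self-dual space (SSD space) is a pair $(B,\lfloor\cdot,\cdot\rfloor)$ where $B$ is a nonzero real vector space and $\lfloor\cdot,\cdot\rfloor:B\times B\to\mathbb{R}$ is a symmetric bilinear form. Put $q:B\to\mathbb{R}$, $q(b)=\frac12\lfloor b,b\rfloor$. $B$ is a Banach SSD space (Simons space) if it is an SSD space with a norm $\|\cdot\|$ making it a Banach space with norm-dual $B^*$, such that $\frac12\|\cdot\|^2+q\geq 0$ on $B$ and there exists a linear continuous map $\iota:B\to B^*$ with $\langle b,\iota(c)\rangle=\lfloor b,c\rfloor$ for all $b,c\in B$. A set $A\subseteq B$ is $q$-positive if $A\neq\emptyset$ and $q(b-c)\geq 0$ for all $b,c\in A$; it is maximally $q$-positive if it is $q$-positive and maximal with respect to inclusion among the $q$-positive subsets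 of $B$. $\mathbb{R}_+=[0,+\infty)$, $\overline{\mathbb{R}}=\mathbb{R}\cup\{\pm\infty\}$. The graph of $E:\mathbb{R}_+\rightrightarrows B$ is $G(E)=\{(\varepsilon,b)\in\mathbb{R}_+\times B: b\in E(\varepsilon)\}$, and $\overline{E}:\mathbb{R}_+\rightrightarrows B$ is defined by $\overline{E}(\varepsilon)=\{b\in B:(\varepsilon,b)\in\overline{G(E)}\}$ (closure in the norm topology). A multifunction $E:\mathbb{R}_+\rightrightarrows B$ satisfies the transportation formula if for all $\varepsilon_1,\varepsilon_2\geq 0$, $b^1\in E(\varepsilon_1)$, $b^2\in E(\varepsilon_2)$ and all $\alpha_1,\alpha_2\geq 0$ with $\alpha_1+\alpha_2=1$ one has $\varepsilon:=\alpha_1\varepsilon_1+\alpha_2\varepsilon_2+\alpha_1\alpha_2 q(b^1-b^2)\geq 0$ and $\alpha_1b^1+\alpha_2b^2\in E(\varepsilon)$. $\mathbb{E}(A)$ is the family of multifunctions $E:\mathbb{R}_+\rightrightarrows B$ such that: (r1) $A\subseteq E(\varepsilon)$ for all $\varepsilon\geq 0$; (r2) $0\leq\varepsilon_1\leq\varepsilon_2$ implies $E(\varepsilon_1)\subseteq E(\varepsilon_2)$; (r3) $E$ satisfies the transportation formula. Put $E^A(\varepsilon)=\{b\in B:q(b-c)\geq-\varepsilon\text{ for all }c\in A\}$ and $E_A(\varepsilon)=\bigcap_{E\in\mathbb{E}(A)}E(\varepsilon)$ for $\varepsilon\geq 0$. For $E:\mathbb{R}_+\rightrightarrows B$, define $\lambda_E:B\to\overline{\mathbb{R}}$,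 $\lambda_E(b)=\inf\{\varepsilon\geq 0:b\in E(\varepsilon)\}$ (with $\inf\emptyset=+\infty$), and $\Lambda_E:=\lambda_E+q$. For $h:B\to\overline{\mathbb{R}}$ put $\mathcal{P}(h)=\{b\in B:h(b)=q(b)\}$. $\mathcal{H}(A)$ is the family of convex lower semicontinuous functions $h:B\to\overline{\mathbb{R}}$ such that $h\geq q$ on $B$ and $A\subseteq\mathcal{P}(h)$. *)

(* Defs.v *)
From HB Require Import structures.
From mathcomp Require Import all_boot all_order all_algebra.
From mathcomp Require Import all_classical all_reals all_analysis.

Set Implicit Arguments.
Unset Strict Implicit.
Unset Printing Implicit Defensive.

Import Order.TTheory GRing.Theory Num.Theory.
Import numFieldNormedType.Exports.

Local Open Scope classical_set_scope.
Local Open Scope ring_scope.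

Section dual_space.
Context {R : realType} (V : normedModType R).

Definition continuous_functional : {pred V -> R^o} :=
  [pred f : V -> R^o | `[< linear f /\ continuous f >]].

Lemma continuous_functional_submod : submod_closed continuous_functional.
Proof.
split=> [|a f g].
- rewrite inE; split=> [k x y|]; last exact: cst_continuous.
  by rewrite /GRing.zero/= scaler0 addr0.
- rewrite !inE => -[lf cf] [lg cg]; split=> [k x y|x].
    rewrite !fctE lf lg !scalerDr !scalerA (mulrC a k) -!addrA; congr (_ + _).
    by rewrite addrCA.
  by apply: cvgD; [apply: cvgZl_tmp; exact: cf|exact: cg].
Qed.

HB.instance Definition _ := GRing.isSubmodClosed.Build R (V -> R^o)
  continuous_functional continuous_functional_submod.

Record dual := Dual {
  dual_fun :> V -> R^o ;
  _ : dual_fun \in continuous_functional }.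

HB.instance Definition _ := [isSub for dual_fun].
HB.instance Definition _ := [Choice of dual by <:].
HB.instance Definition _ := [SubChoice_isSubLmodule of dual by <:].

Lemma dual_linear (f : dual) : linear f.
Proof. by case: f => f /=; rewrite inE => -[]. Qed.

Lemma dual_continuous (f : dual) : continuous f.
Proof. by case: f => f /=; rewrite inE => -[]. Qed.

HB.instance Definition _ (f : dual) :=
  GRing.isLinear.Build R V R^o *:%R f (dual_linear f).

Definition dual_norm (f : dual) : R :=
  sup [set `|f x| | x in [set x : V | `|x| <= 1]].

Lemma dual_norm_has_sup (f : dual) :
  has_sup [set `|f x| | x in [set x : V | `|x| <= 1]].
Proof.
split; first by exists `|f 0|, 0; rewrite //= normr0.
have /linear_boundedP/pinfty_ex_gt0[M M0 fM] :=
  continuous_linear_bounded 0 (@dual_continuous f 0).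
exists M => _ [x /= x1 <-]; apply: (le_trans (fM x)).
by rewrite ler_piMr // ltW.
Qed.

Lemma dual_norm_le (f : dual) (M : R) :
  (forall x : V, `|x| <= 1 -> `|f x| <= M) -> dual_norm f <= M.
Proof.
move=> fM; apply: ge_sup; first by case: (dual_norm_has_sup f).
by move=> _ [x /= x1 <-]; exact: fM.
Qed.

Lemma dual_norm_ge (f : dual) (x : V) : `|x| <= 1 -> `|f x| <= dual_norm f.
Proof.
by move=> x1; apply: sup_upper_bound; [exact: dual_norm_has_sup|exists x].
Qed.

Lemma dual_normD (f g : dual) : dual_norm (f + g) <= dual_norm f + dual_norm g.
Proof.
apply: dual_norm_le => x x1; apply: (le_trans (ler_normD _ _)).
by apply: lerD; exact: dual_norm_ge.
Qed.

Lemma dual_normZ (a : R) (f : dual) : dual_norm (a *: f) = `|a| * dual_norm f.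
Proof.
have le_normZ b g : dual_norm (b *: g) <= `|b| * dual_norm g.
  apply: dual_norm_le => x x1; rewrite [leLHS]normrM.
  by rewrite ler_wpM2l // dual_norm_ge.
apply/eqP; rewrite eq_le le_normZ /=.
have [->|a0] := eqVneq a 0.
  rewrite normr0 mul0r; apply: le_trans (dual_norm_ge _ (_ : `|0| <= 1)) => //.
  by rewrite normr0.
have := le_normZ a^-1 (a *: f).
by rewrite scalerA mulVf // scale1r normfV ler_pdivlMl // normr_gt0.
Qed.

Lemma dual_norm0_eq0 (f : dual) : dual_norm f = 0 -> f = 0.
Proof.
move=> f0; apply/val_inj/funext => x /=.
have [->|x0] := eqVneq x 0; first by rewrite linear0.
have : `|f (`|x|^-1 *: x)| <= 0.
  by rewrite -f0 dual_norm_ge // normrZ normfV normr_id mulVf ?normr_eq0.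
rewrite normr_le0 linearZ/= => /eqP/eqP.
by rewrite scaler_eq0 invr_eq0 normr_eq0 (negbTE x0) /= => /eqP.
Qed.

HB.instance Definition _ := Lmodule_isNormed.Build R dual
  dual_normD dual_normZ dual_norm0_eq0.

End dual_space.

Section ssd_space.
Context {R : realType} {B : completeNormedModType R} (s : {symmetric B}).

Definition q (b : B) : R := 2^-1 * s b b.

Definition banach_ssd : Prop :=
  [/\ exists b : B, b != 0,
      forall b : B, 0 <= 2^-1 * `|b| ^+ 2 + q b
    & exists iota : {linear B -> dual B},
        continuous iota /\ forall b c : B, iota c b = s b c].

Definition q_positive (A : set B) : Prop :=
  A !=set0 /\ forall b c, A b -> A c -> 0 <= q (b - c).

Definition maximally_q_positive (A : set B) : Prop :=
  q_positive A /\ forall C, q_positive C -> A `<=` C -> C = A.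

(* The graph is taken in R * B. Since the nonnegative reals are closed in R,
   its closure there coincides with its closure in R_+ * B. *)
Definition graph (E : {nonneg R} -> set B) : set (R * B) :=
  [set p | exists2 e : {nonneg R}, p.1 = e%:num & E e p.2].

Definition closure_mfun (E : {nonneg R} -> set B) : {nonneg R} -> set B :=
  fun e => [set b | closure (graph E) (e%:num, b)].

(* The existence of e : {nonneg R} includes the requirement that the
   combination of e1, e2 and q (b1 - b2) be nonnegative. *)
Definition transportation_formula (E : {nonneg R} -> set B) : Prop :=
  forall (e1 e2 : {nonneg R}) (b1 b2 : B), E e1 b1 -> E e2 b2 ->
  forall a1 a2 : R, 0 <= a1 -> 0 <= a2 -> a1 + a2 = 1 ->
  exists2 e : {nonneg R},
    e%:num = a1 * e1%:num + a2 * e2%:num + a1 * a2 * q (b1 - b2)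
    & E e (a1 *: b1 + a2 *: b2).

Definition enlargements (A : set B) : set ({nonneg R} -> set B) :=
  [set E | [/\ forall e, A `<=` E e,
               forall e1 e2 : {nonneg R},
                 e1%:num <= e2%:num -> E e1 `<=` E e2
             & transportation_formula E]].

Definition enlargement_max (A : set B) : {nonneg R} -> set B :=
  fun e => [set b | forall c, A c -> - e%:num <= q (b - c)].

Definition enlargement_min (A : set B) : {nonneg R} -> set B :=
  fun e => \bigcap_(E in enlargements A) E e.

Definition lambda (E : {nonneg R} -> set B) (b : B) : \bar R :=
  ereal_inf [set (e%:num)%:E | e in [set e : {nonneg R} | E e b]].

Definition Lambda (E : {nonneg R} -> set B) (b : B) : \bar R :=
  (lambda E b + (q b)%:E)%E.

(* The sum is the dual addition of extended reals, for which
   +oo + -oo = +oo, as is the custom in convex analysis. *)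
Definition convex_efun (h : B -> \bar R) : Prop :=
  forall (x y : B) (t : R), 0 < t -> t < 1 ->
    (h (t *: x + (1 - t) *: y)%R <= t%:E * h x + (1 - t)%:E * h y)%dE.

Definition coincidence (h : B -> \bar R) : set B := [set b | h b = (q b)%:E].

Definition representatives (A : set B) : set (B -> \bar R) :=
  [set h | [/\ convex_efun h, lower_semicontinuous h,
               forall b, ((q b)%:E <= h b)%E & A `<=` coincidence h]].

End ssd_space.

(* Main.v *)
Require Import Defs.
From HB Require Import structures.
From mathcomp Require Import all_boot all_order all_algebra.
From mathcomp Require Import all_classical all_reals all_analysis.
From mathcomp Require Import ring lra.

Set Implicit Arguments.
Unset Strict Implicit.
Unset Printing Implicit Defensive.

Import Order.TTheory GRing.Theory Num.Theory.
Import numFieldNormedType.Exports.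

Local Open Scope classical_set_scope.
Local Open Scope ring_scope.

(** Enlargements and representative functions are two descriptions of the
same objects.  A multifunction E corresponds to the function
[Lambda E = lambda E + q], and a function h above q corresponds to the
multifunction [sublevel_mfun h], whose value at e is the set where
[h <= q + e].  Larger multifunctions give smaller functions ([Lambda_anti]).

Because of the identity
  q (a1 x + a2 y) = a1 q x + a2 q y - a1 a2 q (x - y)   (a1 + a2 = 1),
the quadratic term in the transportation formula is what turns the
convexity inequality for h into an inequality for the gap h - q.  Hence
- an enlargement of A with closed graph has its [Lambda] in H(A)
  ([Lambda_representative]): transportation gives convexity, closedness of the
  graph gives lower semicontinuity, and A being contained in E(0) gives the
  equality with q on A;
- h in H(A) comes from an enlargement with closed graph, since
  [sublevel_mfun h] is one ([sublevel_enlargement], [closed_graph_sublevel])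
  and [Lambda (sublevel_mfun h) = h] ([Lambda_sublevel]).

The extremal elements of H(A) are therefore the images of the extremal
enlargements with closed graph.  Every enlargement E of A lies below E^A
([subset_enlargement_max]: apply the transportation formula to a point of
E(e) and a point of A, and let the weight of the latter tend to 1).  When A
is maximally q-positive, E^A is itself an enlargement and its graph is
closed.  At the other end, E_A is an enlargement as an intersection of a
nonempty family of enlargements, closing its graph preserves the axioms
because q is continuous, and the result lies below every enlargement with
closed graph.  Applying [Lambda] to
  closure of E_A <= sublevel_mfun h <= E^A
gives the bounds on h; conversely, a function squeezed between two members of
H(A) is above q and equal to q on A. *)

Section ssd_enlargements.
Context {R : realType} {B : completeNormedModType R} (s : {symmetric B}).

Local Notation q := (q s).

(** * The quadratic form *)

Lemma formC b c : s b c = s c b.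
Proof. by rewrite hermC expr0 mul1r. Qed.

Lemma formDl b c d : s (b + c) d = s b d + s c d.
Proof. exact: linearDl. Qed.

Lemma formDr b c d : s d (b + c) = s d b + s d c.
Proof. exact: linearDr. Qed.

Lemma formZl a b c : s (a *: b) c = a * s b c.
Proof. exact: linearZl_LR. Qed.

Lemma formZr a b c : s c (a *: b) = a * s c b.
Proof. by rewrite formC formZl formC. Qed.

Lemma qZD a1 a2 x y : q (a1 *: x + a2 *: y) =
  a1 ^+ 2 * q x + a1 * a2 * s x y + a2 ^+ 2 * q y.
Proof.
rewrite /Defs.q !(formDl, formDr, formZl, formZr) (formC y x); by field.
Qed.

Lemma qB x y : q (x - y) = q x - s x y + q y.
Proof. by have := qZD 1 (-1) x y; rewrite scale1r scaleN1r => ->; ring. Qed.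

Lemma q_segment a1 a2 x y : a1 + a2 = 1 ->
  q (a1 *: x + a2 *: y) = a1 * q x + a2 * q y - a1 * a2 * q (x - y).
Proof.
move=> a12; rewrite qZD qB; have -> : a2 = 1 - a1 by rewrite -a12; ring.
by ring.
Qed.

Lemma q0 : q 0 = 0.
Proof. by have := qZD 0 0 0 0; rewrite !scale0r addr0 => ->; ring. Qed.

(** Near 0, [2 q z = iota z z] is bounded by the dual norm of [iota z]; near x,
[q y - q x = s (y - x) x + q (y - x)] is the value at [y - x] of a continuous
functional plus a term covered by the first case. *)
Lemma q_continuous : banach_ssd s -> continuous q.
Proof.
move=> [_ _ [iota [ciota iotaE]]].
have q_at0 : q z @[z --> (0 : B)] --> (0 : R).
  apply/cvgr0Pnorm_lt => e e0.
  have /cvgr0Pnorm_lt /(_ _ e0) : iota z @[z --> (0 : B)] --> (0 : dual B).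
    by rewrite -[X in _ --> X](linear0 iota); exact: ciota.
  have /cvgr0Pnorm_lt /(_ _ ltr01) : (z : B) @[z --> (0 : B)] --> (0 : B).
    exact: cvg_id.
  apply: filterS2 => z z1 ze; rewrite /Defs.q -iotaE.
  have := dual_norm_ge (iota z) (ltW z1); rewrite normrM => /le_lt_trans/(_ ze).
  rewrite ger0_norm ?invr_ge0 //; have := normr_ge0 (iota z z : R).
  by move=> ? ?; lra.
move=> x.
have qE : q = (fun y => q x + (iota x (y - x) + q (y - x))).
  by apply/funext => y; rewrite iotaE linearBl qB /Defs.q; field.
have cB : (y - x) @[y --> x] --> (0 : B).
  rewrite -[X in _ --> X](subrr x).
  by apply: cvgB; [exact: cvg_id|exact: cvg_cst].
rewrite /continuous_at [in X in X @ _ --> _]qE.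
rewrite -[X in _ --> X]addr0; apply: cvgD; first exact: cvg_cst.
rewrite -[X in _ --> X]addr0; apply: cvgD.
  rewrite -[X in _ --> X](linear0 (iota x)).
  by apply: (cvg_comp _ _ cB); exact: dual_continuous.
exact: (cvg_comp _ _ cB).
Qed.

(** * From enlargements to functions *)

Implicit Types (E F : {nonneg R} -> set B) (A : set B) (h : B -> \bar R).

Lemma lambda_ge0 E b : (0 <= lambda E b)%E.
Proof. by apply: le_ereal_inf_tmp => _ [e _ <-]; rewrite lee_fin. Qed.

Lemma lambda_le E (e : {nonneg R}) b : E e b -> (lambda E b <= e%:num%:E)%E.
Proof. by move=> Eb; apply: ereal_inf_lbound; exists e. Qed.

Lemma Lambda_anti E F b : (forall e, E e `<=` F e) ->
  (Lambda s F b <= Lambda s E b)%E.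
Proof.
move=> EF; rewrite leeD2r //; apply: ereal_inf_le_tmp => _ [e Ee <-].
by exists e => //; exact: EF.
Qed.

Lemma graph_num E (e : {nonneg R}) b : graph E (e%:num, b) <-> E e b.
Proof.
split=> [[e' /= ee' Eb]|]; last by exists e.
by rewrite (_ : e = e') //; apply/val_inj.
Qed.

(** For a closed graph the infimum defining lambda is attained: by
monotonicity b lies in E(t) for all t above lambda, and t can tend to it
inside the graph. *)
Lemma lambda_le_graph A E b (r : R) : enlargements s A E -> closed (graph E) ->
  (lambda E b <= r%:E)%E <-> graph E (r, b).
Proof.
move=> [_ monoE _] clE; split=> [lr|[e /= -> /lambda_le//]].
apply: (@closed_cvg _ _ r^'+ _ (fun t : R => (t, b)) _ clE).
  near=> t.
  have : (lambda E b < t%:E)%E.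
    by apply: (le_lt_trans lr); rewrite lte_fin; near: t; exact: nbhs_right_gt.
  move=> /ereal_inf_lt[_ [e Ee <-]]; rewrite lte_fin => et.
  have t0 : 0 <= t by exact: le_trans (ltW et).
  by exists (NngNum t0) => //; apply: monoE Ee; exact: ltW.
apply: (@cvg_pair _ _ _ _ (nbhs r) (nbhs b)); last exact: cvg_cst.
exact: cvg_at_right_filter.
Unshelve. all: by end_near. Qed.

(** The epigraph of Lambda is the graph of E, sheared by q. *)
Lemma Lambda_le_graph A E b (r : R) : enlargements s A E -> closed (graph E) ->
  (Lambda s E b <= r%:E)%E <-> graph E (r - q b, b).
Proof.
by move=> EA clE; rewrite -(lambda_le_graph b _ EA clE) EFinB leeBrDr.
Qed.

(** Convexity is transportation between points of the epigraph, which exist by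
attainment; lower semicontinuity holds as the sublevel sets are preimages of
the closed graph under [b |-> (a - q b, b)]. *)
Lemma Lambda_representative A E : banach_ssd s ->
  enlargements s A E -> closed (graph E) -> representatives s A (Lambda s E).
Proof.
move=> ssd EA clE; have [AE monoE trE] := EA.
have Lambda_ge b : ((q b)%:E <= Lambda s E b)%E by rewrite leeDr ?lambda_ge0.
split => //.
- move=> x y t t0 t1; have t'0 : 0 < 1 - t by rewrite subr_gt0.
  have := Lambda_ge x; have := Lambda_ge y.
  case Ey : (Lambda s E y) => [ly| |] // _;
    case Ex : (Lambda s E x) => [lx| |] // _; last 3 first.
  (* when one of the values is +oo, so is the right-hand side *)
  + by rewrite gt0_muley ?lte_fin // leey.
  + by rewrite gt0_muley ?lte_fin // leey.
  + by rewrite !gt0_muley ?lte_fin // leey.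
  have /(Lambda_le_graph x lx EA clE)[e1 /= e1E E1] : (Lambda s E x <= lx%:E)%E.
    by rewrite Ex.
  have /(Lambda_le_graph y ly EA clE)[e2 /= e2E E2] : (Lambda s E y <= ly%:E)%E.
    by rewrite Ey.
  have [|e eE Ee] := trE _ _ _ _ E1 E2 t (1 - t) (ltW t0) (ltW t'0).
    by rewrite subrKC.
  apply/(Lambda_le_graph _ _ EA clE); exists e => //=.
  by rewrite eE -e1E -e2E q_segment ?subrKC //; ring.
- apply/lower_semicontinuousP => a.
  rewrite (_ : [set x | _] = ~` ((fun b => (a - q b, b)) @^-1` graph E)).
    rewrite openC; apply: closed_comp => // b _.
    apply: (@cvg_pair _ _ _ _ (nbhs (a - q b)) (nbhs b)); last exact: cvg_id.
    by apply: cvgB; [exact: cvg_cst|exact: q_continuous].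
  apply/seteqP; split => b /=; rewrite ltNge.
    by move=> /negP + /(Lambda_le_graph _ _ EA clE).
  by move=> nG; apply/negP => /(Lambda_le_graph _ _ EA clE).
- move=> b Ab; apply/eqP; rewrite eq_le Lambda_ge andbT.
  by apply/(Lambda_le_graph _ _ EA clE); exists 0%:nng; rewrite ?subrr//; exact: AE.
Qed.

(** * From functions to enlargements *)

Definition sublevel_mfun h : {nonneg R} -> set B :=
  fun e => [set b | (h b <= (q b + e%:num)%:E)%E].

(** As [q <= h], the inequality forces r to be nonnegative. *)
Lemma graph_sublevelP h r b : (forall b, ((q b)%:E <= h b)%E) ->
  graph (sublevel_mfun h) (r, b) <-> (h b <= (q b + r)%:E)%E.
Proof.
move=> qh; split=> [[e /= ->]//|hr].
have r0 : 0 <= r by have := le_trans (qh b) hr; rewrite lee_fin lerDl.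
by exists (NngNum r0).
Qed.

Lemma Lambda_sublevel h b : (forall b, ((q b)%:E <= h b)%E) ->
  Lambda s (sublevel_mfun h) b = h b.
Proof.
move=> qh; apply/eqP; rewrite eq_le; apply/andP; split.
  case hb : (h b) => [r| |]; [|exact: leey|by have := qh b; rewrite hb].
  have : graph (sublevel_mfun h) (r - q b, b).
    by apply/(graph_sublevelP _ _ qh); rewrite hb subrKC.
  by move=> [e /= eE /lambda_le]; rewrite -eE EFinB leeBrDr.
rewrite /Lambda -leeBlDr //; apply: le_ereal_inf_tmp => _ [e hbe <-].
by rewrite leeBlDr // -EFinD addrC.
Qed.

(** Convexity with real bounds instead of values of h, so that the weights 0
and 1 can be included. *)
Lemma representative_segment A h x y (t u : R) : representatives s A h ->
  0 <= t -> t <= 1 -> (h x <= u%:E)%E -> forall v, (h y <= v%:E)%E ->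
  (h (t *: x + (1 - t) *: y)%R <= (t * u + (1 - t) * v)%:E)%E.
Proof.
move=> [convh _ _ _]; rewrite le_eqVlt => /predU1P[<- _ _ v hv|t0].
  by rewrite scale0r subr0 scale1r add0r mul0r mul1r add0r.
rewrite le_eqVlt => /predU1P[-> hu v _|t1 hu v hv].
  by rewrite subrr scale0r scale1r addr0 mul0r mul1r addr0.
apply: (le_trans (convh x y t t0 t1)).
rewrite [leRHS]EFinD !EFinM.
rewrite -DualAddTheoryNumDomain.dual_addeE_def //.
by apply: DualAddTheoryRealDomain.lee_dD; rewrite lee_pmul2l // lte_fin subr_gt0.
Qed.

(** Transportation is convexity of h rewritten by [q_segment]; the new level is
nonnegative because [q <= h] at the combined point. *)
Lemma sublevel_enlargement A h :
  representatives s A h -> enlargements s A (sublevel_mfun h).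
Proof.
move=> hA; have [_ _ qh Ah] := hA; split.
- by move=> e b /Ah hb; rewrite /sublevel_mfun/= hb lee_fin lerDl.
- by move=> e1 e2 e12 b /= /le_trans; apply; rewrite lee_fin lerD2l.
- move=> e1 e2 b1 b2 h1 h2 a1 a2 a10 a20 a12.
  have a2E : a2 = 1 - a1 by rewrite -a12 addrC addKr.
  have a1_le1 : a1 <= 1 by rewrite -a12 lerDl.
  have := representative_segment hA a10 a1_le1 h1 h2; rewrite -a2E => hb.
  set e := a1 * e1%:num + a2 * e2%:num + a1 * a2 * q (b1 - b2).
  have [|e' /= -> he'] := (@graph_sublevelP h e (a1 *: b1 + a2 *: b2) qh).2.
    by apply: (le_trans hb); rewrite lee_fin /e (q_segment _ _ a12); lra.
  by exists e'.
Qed.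

(** The complement of the graph is the set where [q b + r < h b], which is open
because q is continuous and h is lower semicontinuous. *)
Lemma closed_graph_sublevel A h : banach_ssd s ->
  representatives s A h -> closed (graph (sublevel_mfun h)).
Proof.
move=> ssd [_ lsch qh _].
have -> : graph (sublevel_mfun h) =
    ~` [set p : R * B | ((q p.2 + p.1)%:E < h p.2)%E].
  apply/seteqP; split => -[r b]; rewrite /= (graph_sublevelP _ _ qh) leNgt.
    by move/negP.
  by move/negP.
rewrite closedC openE => -[r b] /= hrb.
have [a ra ah] : exists2 a, q b + r < a & (a%:E < h b)%E.
  case: (h b) hrb => [u| |] //.
    rewrite lte_fin => /midf_lt[lt1 lt2]; exists ((q b + r + u) / 2) => //.
  by exists (q b + r + 1); rewrite ?ltry // ltrDl.
have [V Vb Vh] := lsch _ _ ah.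
have cq : (fun p : R * B => q p.2 + p.1) @ nbhs (r, b) --> q b + r.
  apply: cvgD; last exact: cvg_fst.
  apply: (@cvg_comp _ _ _ snd q _ (nbhs b)); first exact: cvg_snd.
  exact: q_continuous.
have : \forall p \near (r, b), V p.2 by exact: (@cvg_snd R B (nbhs r) (nbhs b)).
have : \forall p \near (r, b), q p.2 + p.1 < a.
  by apply: (cvgr_lt _ cq).
rewrite /interior/=; apply: filterS2 => p pa /Vh; apply: le_lt_trans.
by rewrite lee_fin ltW.
Qed.

(** * The largest enlargement *)

(** Transport b in E(e) and c in A (at level 0) with weights 1 - t and t: the
resulting level [(1 - t) (e + t q (b - c))] is nonnegative for all t < 1, and
t can come arbitrarily close to 1. *)
Lemma subset_enlargement_max A E : enlargements s A E ->
  forall e, E e `<=` enlargement_max s A e.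
Proof.
move=> [AE _ trE] e b Eb c Ac.
have tr t : 0 <= t -> t < 1 -> 0 <= e%:num + t * q (b - c).
  move=> t0 t1; have t'0 : 0 < 1 - t by rewrite subr_gt0.
  have [|e' /= + _] := trE e 0%:nng b c Eb (AE _ _ Ac) (1 - t) t (ltW t'0) t0.
    by rewrite subrK.
  rewrite mulr0 addr0 -mulrA -mulrDr => e'E.
  by rewrite -(pmulr_rge0 _ t'0) -e'E.
rewrite -subr_ge0 opprK addrC.
have [q0|q_lt0] := leP 0 (q (b - c)); first exact: addr_ge0.
rewrite leNgt; apply/negP => neg.
have e0 : 0 <= e%:num by [].
set x := q (b - c) in tr q_lt0 neg *.
(* at this weight, e + t x is the average of 0 and e + x, half of e + x *)
have := tr ((x - e%:num) / (2 * x)).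
have xE : x != 0 by rewrite lt_eqF.
have -> : e%:num + (x - e%:num) / (2 * x) * x = (e%:num + x) / 2 by field.
have x2 : 2 * x < 0 by lra.
rewrite ler_ndivlMr // ltr_ndivrMr // => half; have := half _ _; lra.
Qed.

(** Adding such a point b to A keeps it q-positive. *)
Lemma maximal_mem A b : maximally_q_positive s A ->
  (forall c, A c -> 0 <= q (b - c)) -> A b.
Proof.
move=> [[[a Aa] Apos] Amax] bA.
have qN x y : q (x - y) = q (y - x) by rewrite !qB formC; ring.
suff <- : A `|` [set b] = A by right.
apply: Amax; last by move=> c; left.
split; first by exists a; left.
move=> c d [Ac|->] [Ad|->]; [exact: Apos|by rewrite qN; exact: bA|exact: bA|].
by rewrite subrr q0.
Qed.

(** Maximality serves to show that the transported level e is nonnegative: if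
e < 0, the combined point b has [q (b - c) >= - e > 0] for all c in A, so it
belongs to A, and c := b is a contradiction. *)
Lemma enlargement_max_enlargement A : maximally_q_positive s A ->
  enlargements s A (enlargement_max s A).
Proof.
move=> Amax; have [[_ Apos] _] := Amax; split.
- by move=> e b Ab c Ac; apply: le_trans (Apos _ _ Ab Ac); rewrite oppr_le0.
- by move=> e1 e2 e12 b be1 c /be1; apply: le_trans; rewrite lerN2.
- move=> e1 e2 b1 b2 h1 h2 a1 a2 a10 a20 a12.
  set b := a1 *: b1 + a2 *: b2.
  set e := a1 * e1%:num + a2 * e2%:num + a1 * a2 * q (b1 - b2).
  have be c : A c -> - e <= q (b - c).
    move=> Ac; have -> : b - c = a1 *: (b1 - c) + a2 *: (b2 - c).
      by rewrite !scalerBr addrACA -opprD -scalerDl a12 scale1r.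
    rewrite q_segment // (_ : b1 - c - (b2 - c) = b1 - b2); last first.
      by rewrite opprB addrA subrK.
    have := ler_wpM2l a10 (h1 c Ac); have := ler_wpM2l a20 (h2 c Ac).
    by rewrite /e; lra.
  have e0 : 0 <= e.
    rewrite leNgt; apply/negP => e_lt0.
    have Ne : 0 <= - e by rewrite oppr_ge0 ltW.
    have Ab : A b.
      by apply: (maximal_mem Amax) => c Ac; exact: le_trans Ne (be c Ac).
    by have := be b Ab; rewrite subrr q0; lra.
  by exists (NngNum e0).
Qed.

Lemma closed_graph_enlargement_max A : banach_ssd s ->
  maximally_q_positive s A -> closed (graph (enlargement_max s A)).
Proof.
move=> ssd Amax.
have -> : graph (enlargement_max s A) =
    [set p | 0 <= p.1] `&`
    \bigcap_(c in A) [set p : R * B | 0 <= q (p.2 - c) + p.1].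
  apply/seteqP; split => [[r b] [e /= -> be]|[r b] /= [r0 rb]].
    by split=> //= c Ac; rewrite /= -lerBlDr sub0r be.
  exists (NngNum r0) => //= c Ac.
  by have := rb c Ac; rewrite /= -lerBlDr sub0r.
apply: closedI.
  apply: (@closed_comp _ _ fst [set x : R | 0 <= x]); last exact: closed_ge.
  by move=> p _; exact: cvg_fst.
apply: closed_bigI => c _.
apply: (@closed_comp _ _ (fun p : R * B => q (p.2 - c) + p.1)
  [set x : R | 0 <= x]); last exact: closed_ge.
move=> [r b] _; apply: cvgD; last exact: cvg_fst.
apply: (@cvg_comp _ _ _ (fun p : R * B => p.2 - c) q _ (nbhs (b - c)));
  last exact: q_continuous.
by apply: cvgB; [exact: cvg_snd|exact: cvg_cst].
Qed.

(** * The smallest enlargement with closed graph *)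

Lemma closure_maps (T U : topologicalType) (f : T -> U) (G : set T) (C : set U) :
  continuous f -> closed C -> (forall x, G x -> C (f x)) ->
  forall x, closure G x -> C (f x).
Proof.
move=> cf cC GC; rewrite closureE; apply: smallest_sub => //.
by apply: closed_comp => // x _; exact: cf.
Qed.

(** Stated for two arbitrary functions so that either argument of the
transportation map can be held fixed. *)
Lemma transport_continuous (T : topologicalType) (f g : T -> R * B) a1 a2 :
  banach_ssd s -> continuous f -> continuous g ->
  continuous (fun x => (a1 * (f x).1 + a2 * (g x).1
                          + a1 * a2 * q ((f x).2 - (g x).2),
                        a1 *: (f x).2 + a2 *: (g x).2)).
Proof.
move=> ssd cf cg x.
have f1 : (f y).1 @[y --> x] --> (f x).1.
  by apply: cvg_comp (cf x) _; exact: cvg_fst.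
have f2 : (f y).2 @[y --> x] --> (f x).2.
  by apply: cvg_comp (cf x) _; exact: cvg_snd.
have g1 : (g y).1 @[y --> x] --> (g x).1.
  by apply: cvg_comp (cg x) _; exact: cvg_fst.
have g2 : (g y).2 @[y --> x] --> (g x).2.
  by apply: cvg_comp (cg x) _; exact: cvg_snd.
apply: (@cvg_pair _ _ _ _ (nbhs _) (nbhs _)); last first.
  by apply: cvgD; apply: cvgZl_tmp.
apply: cvgD; first by apply: cvgD; apply: cvgMl_tmp.
apply: cvgMl_tmp.
apply: (@cvg_comp _ _ _ (fun y => (f y).2 - (g y).2) q _
  (nbhs ((f x).2 - (g x).2))); last exact: q_continuous.
exact: cvgB.
Qed.

Lemma graph_closure_mfun E : graph (closure_mfun E) = closure (graph E).
Proof.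
apply/seteqP; split => [[r b] [e /= -> //]|[r b] Erb].
have r0 : 0 <= r.
  apply: (@closure_maps _ _ fst (graph E) [set x : R | 0 <= x] _ _ _ (r, b)) => //.
  - by move=> p; exact: cvg_fst.
  - by move=> _ [e -> _] /=.
by exists (NngNum r0).
Qed.

Lemma closed_graph_closure_mfun E : closed (graph (closure_mfun E)).
Proof. by rewrite graph_closure_mfun; exact: closed_closure. Qed.

(** Both axioms that relate different levels say that a continuous map sends
the graph into itself (a translation of the level for monotonicity, the
transportation map for the other axiom), hence pass to the closure. *)
Lemma closure_mfun_enlargement A E : banach_ssd s ->
  enlargements s A E -> enlargements s A (closure_mfun E).
Proof.
move=> ssd [AE monoE trE]; split.
- by move=> e b Ab; apply: subset_closure; exists e => //; exact: AE.
- move=> e1 e2 e12 b Eb; rewrite /closure_mfun/=.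
  rewrite -(subrK e1%:num e2%:num).
  apply: (@closure_maps _ _ (fun p : R * B => (e2%:num - e1%:num + p.1, p.2))
    (graph E) (closure (graph E)) _ _ _ (e1%:num, b)) => //.
  + move=> p; apply: (@cvg_pair _ _ _ _ (nbhs _) (nbhs _)); last exact: cvg_snd.
    by apply: cvgD; [exact: cvg_cst|exact: cvg_fst].
  + exact: closed_closure.
  + move=> [r c] /= [e /= -> Ec]; apply: subset_closure.
    have e21 : 0 <= e2%:num - e1%:num + e%:num by rewrite addr_ge0 ?subr_ge0.
    by exists (NngNum e21) => //=; apply: monoE Ec; rewrite /= lerDr subr_ge0.
- move=> e1 e2 b1 b2 E1 E2 a1 a2 a10 a20 a12.
  pose tr (p1 p2 : R * B) : R * B :=
    (a1 * p1.1 + a2 * p2.1 + a1 * a2 * q (p1.2 - p2.2), a1 *: p1.2 + a2 *: p2.2).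
  suff [e eE Ee] : graph (closure_mfun E) (tr (e1%:num, b1) (e2%:num, b2)).
    by exists e.
  rewrite graph_closure_mfun.
  have cl : closed (closure (graph E)) by exact: closed_closure.
  (* pass to the closure in one argument at a time *)
  apply: (@closure_maps _ _ (tr _) (graph E) _ _ cl _ _ E2).
    by apply: transport_continuous => // p; [exact: cvg_cst|exact: cvg_id].
  move=> p2 Gp2.
  apply: (@closure_maps _ _ (tr^~ p2) (graph E) _ _ cl _ _ E1).
    by apply: transport_continuous => // p; [exact: cvg_id|exact: cvg_cst].
  move=> p1 [f1 p1E Ef1]; case: Gp2 => f2 p2E Ef2.
  have [f fE Ef] := trE _ _ _ _ Ef1 Ef2 a1 a2 a10 a20 a12.
  by apply: subset_closure; exists f => //=; rewrite fE p1E p2E.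
Qed.

(** Some enlargement has to exist: it provides the nonnegativity of the
transported level. *)
Lemma enlargement_min_enlargement A : enlargements s A !=set0 ->
  enlargements s A (enlargement_min s A).
Proof.
move=> [F FA]; split.
- by move=> e b Ab E [+ _ _]; exact.
- by move=> e1 e2 e12 b Eb E EA; have [_ + _] := EA; apply; [exact: e12|exact: Eb].
- move=> e1 e2 b1 b2 E1 E2 a1 a2 a10 a20 a12.
  have trE E : enlargements s A E -> _ :=
    fun EA => let: And3 _ _ tr := EA in
              tr _ _ _ _ (E1 E EA) (E2 E EA) _ _ a10 a20 a12.
  have [e eE _] := trE F FA; exists e => // E EA.
  by have [e' e'E] := trE E EA; have -> : e' = e by apply/val_inj; rewrite /= e'E.
Qed.

End ssd_enlargements.

Theorem corollary16 (R : realType) (B : completeNormedModType R)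
    (s : {symmetric B}) (A : set B) :
  banach_ssd s -> maximally_q_positive s A ->
  let Lmin := Lambda s (enlargement_max s A) in
  let Lmax := Lambda s (closure_mfun (enlargement_min s A)) in
  [/\ [/\ representatives s A Lmin,
          representatives s A Lmax
        & forall h, representatives s A h ->
            forall b, (Lmin b <= h b)%E /\ (h b <= Lmax b)%E],
      forall h : B -> \bar R,
        convex_efun h -> lower_semicontinuous h ->
        (forall b, (Lmin b <= h b)%E /\ (h b <= Lmax b)%E) ->
        representatives s A h
    & representatives s A =
        [set h | [/\ convex_efun h, lower_semicontinuous h
                   & forall b, (Lmin b <= h b)%E /\ (h b <= Lmax b)%E]]].
Proof.
move=> ssd Amax Lmin Lmax.
have maxA := enlargement_max_enlargement Amax.
have minA : enlargements s A (enlargement_min s A).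
  by apply: enlargement_min_enlargement; exists (enlargement_max s A).
have LminA : representatives s A Lmin.
  exact: Lambda_representative ssd maxA (closed_graph_enlargement_max ssd Amax).
have LmaxA : representatives s A Lmax.
  apply: (Lambda_representative ssd (closure_mfun_enlargement ssd minA)).
  exact: closed_graph_closure_mfun.
have bounds h : representatives s A h ->
    forall b, (Lmin b <= h b)%E /\ (h b <= Lmax b)%E.
  move=> hA b; have [_ _ qh _] := hA; rewrite -(Lambda_sublevel b qh).
  split; apply: Lambda_anti => e c.
    exact: subset_enlargement_max (sublevel_enlargement hA) _ _.
  move=> Ec; apply/graph_num.
  apply: (@closure_maps _ _ id _ _ _ (closed_graph_sublevel ssd hA) _ _ Ec).
    by move=> p; exact: cvg_id.
  move=> [r d] [f /= -> Ef]; apply/graph_num.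
  exact: Ef _ (sublevel_enlargement hA).
have squeeze h : convex_efun h -> lower_semicontinuous h ->
    (forall b, (Lmin b <= h b)%E /\ (h b <= Lmax b)%E) -> representatives s A h.
  move=> convh lsch hb; have [_ _ Lmin_q _] := LminA; have [_ _ _ Lmax_q] := LmaxA.
  have qh b : ((q s b)%:E <= h b)%E.
    by have [+ _] := hb b; exact: le_trans (Lmin_q b).
  split=> // b Ab; apply/eqP; rewrite eq_le qh andbT.
  by have [_] := hb b; rewrite (Lmax_q b Ab).
split=> //; apply/seteqP; split=> [h hA|h [convh lsch hb]]; last exact: squeeze.
by have [convh lsch _ _] := hA; split=> //; exact: bounds.
Qed.
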